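(* We have $$\widetilde{C}(x,x,z;t)=\mathrm{e}^{\,xzt\cdot \operatorname{Cat}(x^2t/2)},$$ where $\operatorname{Cat}(z)=\frac{1-\sqrt{1-4z}}{2z}$ is the generating function for the Catalan numbers $\frac{1}{n+1}\binom{2n}{n}$.
   Context: Let $G=\{x\rightarrow y^2,\ y\rightarrow y^2\}$ and let $D_G$ be the derivation (linear, Leibniz rule, killing constants) on polynomials in the commuting variables $x,y$ with $D_G(x)=y^2$, $D_G(y)=y^2$. The operator $xD_G$ is $f\mapsto xD_G(f)$. For $n\geqslant 1$ the numbers $C_{n,k,\ell}$ are the coefficients in the normal ordered expansion $$(xD_{G})^n=\sum_{k=1}^n\sum_{\ell=k}^nC_{n,k,\ell}x^\ell y^{2n-k-\ell}D_{G}^k;$$ they satisfy, for $n\geqslant1$, $C_{n+1,k,\ell}=\ell C_{n,k,\ell}+(2n-k-\ell+1)C_{n,k,\ell-1}+C_{n,k-1,\ell-1}$ with $C_{1,1,1}=1$ and $C_{1,k,\ell}=0$ if $(k,\ell)\neq(1,1)$. Set $\widetilde{C}_0(x,y,z)=1$ and, for $n\geqslant 1$, $$\widetilde{C}_n(x,y,z)=\sum_{k=1}^n\sum_{\ell=k}^nC_{n,k,\ell}x^\ell y^{2n-k-\ell}z^k.$$ Define $\widetilde{C}(x,x,z;t)=\sum_{n=0}^\infty\widetilde{C}_n(x,x,z)\frac{t^n}{n!}$ as a formal power series in $t$. *)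

(* Defs.v *)
From HB Require Import structures.
From mathcomp Require Import all_boot all_order all_algebra.
From mathcomp Require Export mpoly.

Set Implicit Arguments.
Unset Strict Implicit.
Unset Printing Implicit Defensive.

Import GRing.Theory.
Local Open Scope ring_scope.

(* Formal power series in one variable t over A are coefficient sequences
   nat -> A, compared pointwise (=1). *)
Section FormalSeries.

Variable A : nzRingType.
Implicit Types f g : nat -> A.

(* a t^m *)
Definition fps_monom (a : A) (m : nat) : nat -> A :=
  fun n => if n == m then a else 0.

Definition fps_sub f g : nat -> A := fun n => f n - g n.

Definition fps_mul f g : nat -> A :=
  fun n => \sum_(i < n.+1) f i * g (n - i)%N.

Definition fps_pow f k : nat -> A := iter k (fps_mul f) (fps_monom 1 0).

End FormalSeries.

Section Composition.

Variables (R : fieldType) (A : comAlgType R).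

(* Composition h(g(t)).  Only meaningful when g 0 = 0: then g^k has no
   coefficient in degree n < k, so the sum may be cut at k = n. *)
Definition fps_comp (h : nat -> R) (g : nat -> A) : nat -> A :=
  fun n => \sum_(k < n.+1) h k *: fps_pow g k n.

Definition fps_exp (g : nat -> A) : nat -> A :=
  fps_comp (fun k => (k`!%:R)^-1) g.

End Composition.

(* s is the square root of h with constant term 1, for h with constant
   term 1. *)
Definition fps_is_sqrt (R : fieldType) (h s : nat -> R) : Prop :=
  s 0%N = 1 /\ fps_mul s s =1 h.

Definition Catalan_series (R : fieldType) : nat -> R :=
  fun n => ('C(2 * n, n))%:R / n.+1%:R.

Section Grammar.

Variable R : fieldType.

Definition vx : {mpoly R[2]} := 'X_(inord 0).
Definition vy : {mpoly R[2]} := 'X_(inord 1).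

(* The derivation of the grammar {x -> y^2, y -> y^2}. *)
Definition is_DG (D : {linear {mpoly R[2]} -> {mpoly R[2]}}) : Prop :=
  [/\ forall p q, D (p * q) = D p * q + p * D q,
      forall c : R, D c%:MP = 0,
      D vx = vy ^+ 2 &
      D vy = vy ^+ 2].

(* (x D)^n = sum_(k, l) C n k l x^l y^(2n-k-l) D^k as operators on R[x, y],
   for all n >= 1.  Since k, l <= n, the exponent 2n-k-l is not truncated. *)
Definition normal_ordered_coefs (D : {mpoly R[2]} -> {mpoly R[2]})
    (C : nat -> nat -> nat -> R) : Prop :=
  forall n, (0 < n)%N -> forall f : {mpoly R[2]},
    iter n (fun g => vx * D g) f =
    \sum_(1 <= k < n.+1) \sum_(k <= l < n.+1)
      C n k l *: (vx ^+ l * vy ^+ (2 * n - k - l) * iter k D f).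

Variable A : comAlgType R.

Definition Ctilde (C : nat -> nat -> nat -> R) (n : nat) (x y z : A) : A :=
  if n is 0 then 1 else
  \sum_(1 <= k < n.+1) \sum_(k <= l < n.+1)
    C n k l *: (x ^+ l * y ^+ (2 * n - k - l) * z ^+ k).

Definition Ctilde_series (C : nat -> nat -> nat -> R) (x y z : A) : nat -> A :=
  fun n => (n`!%:R)^-1 *: Ctilde C n x y z.

End Grammar.

(* Main.v *)
Require Import Defs.
From mathcomp Require Import all_boot all_order all_algebra ring zify.
Import GRing.Theory.
Local Open Scope ring_scope.

Set Implicit Arguments.
Unset Strict Implicit.
Unset Printing Implicit Defensive.

(** Restrict polynomials in x, y to the line x = y, with coordinate X.  Since
    D_G = y^2 (d/dx + d/dy), restriction turns D_G into X^2 d/dX and x D_G into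
    X^3 d/dX ([diag_derivation]).  Applied to y^j, the normal ordered
    expansion becomes, after division by X^(j + 2n),
      j (j + 2) ... (j + 2n - 2) = sum_k c(n,k) j (j + 1) ... (j + k - 1),
    where c(n,k) = sum_l C(n,k,l).  These row sums are all that is left of C
    when y is set equal to x.  In characteristic 0 the identity for all
    natural numbers j is an identity of polynomials, and the rising factorials
    are linearly independent, so it determines the c(n,k).  Multiplying by
    j + 2n = (j + k) + (2n - k) shows that the solution obeys
      c(n+1,k) = (2n - k) c(n,k) + c(n,k-1),
    i.e. c(n,k) is the Bessel number (2n-k-1)! / (2^(n-k) (n-k)! (k-1)!)
    ([row_sum_bessel], [natr_bessel]).

    On the other side, the coefficient of t^n in exp (x z t Cat(x^2 t / 2)) is
    a sum over k of (x z)^k / k! times the coefficient of t^(n-k) in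
    Cat(x^2 t / 2)^k ([fps_exp_monom1_comp]).  The powers of Cat have ballot
    numbers as coefficients ([fps_pow_Catalan]); this follows from
    Cat = 1 + t Cat^2, which is equivalent to 1 - 2 t Cat being a square root
    of 1 - 4 t ([sqrt_one_sub_4tP]).  Ballot and Bessel numbers differ by the
    factor that the exponential series and the powers of x^2 / 2 account for
    ([bessel_Catalan]). *)

(** * Products of coefficient sequences *)

(** Transfers the ring laws of polynomials to sequences: a coefficient of a
    product only sees finitely many coefficients of the factors. *)
Lemma fps_mul_trunc (A : nzRingType) (f g : nat -> A) (N n : nat) :
  (n < N)%N ->
  fps_mul f g n = ((\poly_(i < N) f i) * (\poly_(i < N) g i))`_n.
Proof.
move=> ltnN; rewrite coefM; apply: eq_bigr => i _.
have lti : (i < N)%N by exact: leq_ltn_trans (leq_ord i) ltnN.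
by rewrite !coef_poly lti (leq_ltn_trans (leq_subr _ _) ltnN).
Qed.

Lemma fps_mulA (A : nzRingType) (f g h : nat -> A) :
  fps_mul f (fps_mul g h) =1 fps_mul (fps_mul f g) h.
Proof.
move=> n; set T := fun u : nat -> A => \poly_(i < n.+1) u i.
have TE u i : (i <= n)%N -> (T u)`_i = u i by rewrite coef_poly ltnS => ->.
have ME u v i : (i <= n)%N -> (T u * T v)`_i = fps_mul u v i.
  by move=> lein; rewrite -fps_mul_trunc.
transitivity ((T f * (T g * T h))`_n).
  by rewrite coefM; apply: eq_bigr => i _; rewrite TE ?leq_ord // ME ?leq_subr.
rewrite mulrA coefM.
by apply: eq_bigr => i _; rewrite ME ?leq_ord // TE ?leq_subr.
Qed.

Lemma fps_mulC (A : comNzRingType) (f g : nat -> A) :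
  fps_mul f g =1 fps_mul g f.
Proof. by move=> n; rewrite !(@fps_mul_trunc _ _ _ n.+1) // mulrC. Qed.

Lemma eq_fps_mul (A : nzRingType) (f f' g g' : nat -> A) :
  f =1 f' -> g =1 g' -> fps_mul f g =1 fps_mul f' g'.
Proof. by move=> ef eg n; apply: eq_bigr => i _; rewrite ef eg. Qed.

Lemma eq_fps_pow (A : nzRingType) (f f' : nat -> A) (k : nat) :
  f =1 f' -> fps_pow f k =1 fps_pow f' k.
Proof. by move=> ef; elim: k => [|k IHk] //; exact: eq_fps_mul. Qed.

Lemma fps_mul_monom (A : nzRingType) (a : A) (k : nat) (f : nat -> A)
    (n : nat) :
  fps_mul (fps_monom a k) f n = if (k <= n)%N then a * f (n - k)%N else 0.
Proof.
case: leqP => [lekn|ltnk]; last first.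
  rewrite /fps_mul big1 // => i _; rewrite /fps_monom.
  by rewrite ltn_eqF ?mul0r // (leq_ltn_trans (leq_ord i)).
have ltk : (k < n.+1)%N by [].
rewrite /fps_mul (bigD1 (Ordinal ltk)) //= /fps_monom eqxx big1 ?addr0 // => i.
by rewrite -val_eqE /= => /negPf ->; rewrite mul0r.
Qed.

Lemma fps_pow_monom1 (A : comNzRingType) (a : A) (k : nat) :
  fps_pow (fps_monom a 1) k =1 fps_monom (a ^+ k) k.
Proof.
elim: k => [//|k IHk] n; rewrite /fps_pow iterS fps_mul_monom -/(fps_pow _ k).
case: n => [|n]; first by [].
rewrite /= subn1 /= IHk /fps_monom eqSS exprS.
by case: eqP; rewrite ?mulr0.
Qed.

Lemma fps_pow_mul_monom1 (A : comNzRingType) (a : A) (f : nat -> A) (k : nat) :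
  fps_pow (fps_mul (fps_monom a 1) f) k =1
  fps_mul (fps_monom (a ^+ k) k) (fps_pow f k).
Proof.
elim: k => [|k IHk] n; first by rewrite fps_mul_monom mul1r subn0.
rewrite /fps_pow !iterS -!/(fps_pow _ k) (eq_fps_mul (frefl _) IHk).
rewrite -fps_mulA (eq_fps_mul (frefl _) (fps_mulA _ _ _)).
rewrite (eq_fps_mul (frefl _) (eq_fps_mul (fps_mulC _ _) (frefl _))).
rewrite -(eq_fps_mul (frefl _) (fps_mulA _ _ _)) fps_mulA.
apply: eq_fps_mul => // m; rewrite fps_mul_monom.
case: m => [//|m]; rewrite /= subn1 /= /fps_monom eqSS exprS.
by case: eqP; rewrite ?mulr0.
Qed.

Lemma fps_comp_monom1 (R : fieldType) (A : comAlgType R) (f : nat -> R) (a : A)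
    (n : nat) :
  fps_comp f (fps_monom a 1) n = f n *: a ^+ n.
Proof.
rewrite /fps_comp big_ord_recr /= fps_pow_monom1 /fps_monom eqxx.
rewrite big1 ?add0r // => i _.
by rewrite fps_pow_monom1 /fps_monom gtn_eqF ?scaler0.
Qed.

(** Substituting a multiple of the variable commutes with powers. *)
Lemma fps_pow_scale (R : fieldType) (A : comAlgType R) (f : nat -> R) (a : A)
    (k n : nat) :
  fps_pow (fun m => f m *: a ^+ m) k n = fps_pow f k n *: a ^+ n.
Proof.
elim: k n => [|k IHk] n.
  rewrite /fps_pow /= /fps_monom.
  by case: eqP => [->|_]; rewrite ?scale1r ?scale0r.
rewrite /fps_pow !iterS -!/(fps_pow _ k) /fps_mul scaler_suml.
apply: eq_bigr => i _; rewrite IHk -scalerAl -scalerAr scalerA -exprD.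
by rewrite subnKC ?leq_ord.
Qed.

Section CharZero.

Variable R : fieldType.
Hypothesis charR0 : [pchar R] =i pred0.

Local Notation Cat := (@Catalan_series R).

Lemma natr_neq0 (n : nat) : n.+1%:R != 0 :> R.
Proof. by rewrite ((pcharf0P R).1 charR0). Qed.

Lemma fact_neq0 (n : nat) : n`!%:R != 0 :> R.
Proof. by rewrite ((pcharf0P R).1 charR0) -lt0n fact_gt0. Qed.

Lemma add_natr_neq0 (a b : nat) : a.+1%:R + b%:R != 0 :> R.
Proof. by rewrite -natrD addSn natr_neq0. Qed.

Hint Resolve natr_neq0 fact_neq0 : core.

(** * The Catalan series *)

Lemma Catalan0 : Cat 0%N = 1.
Proof. by rewrite /Catalan_series bin0 divr1. Qed.

Lemma Catalan_rec (n : nat) : n.+2%:R * Cat n.+1 = (4 * n%:R + 2) * Cat n.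
Proof.
have E m : Cat m = (2 * m)`!%:R / (m`!%:R * m.+1`!%:R).
  have lem : (m <= 2 * m)%N by lia.
  rewrite /Catalan_series -(bin_fact lem) (_ : 2 * m - m = m)%N; last by lia.
  by rewrite factS !natrM; field; rewrite !fact_neq0 ?nat1r natr_neq0.
rewrite !E (_ : 2 * n.+1 = (2 * n).+2)%N; last by lia.
rewrite !factS !natrM.
by field; rewrite fact_neq0 (add_natr_neq0 0) (add_natr_neq0 1).
Qed.

(** The hypothesis is the differential equation (1 - 4t) s' = -2 s written on
    coefficients.  It gives (1 - 4t) p' = -4 p for p = s^2, whose only solution
    with constant term 1 is 1 - 4t. *)
Lemma fps_sqrt_rec (s : nat -> R) :
  s 0%N = 1 -> (forall n, n.+1%:R * s n.+1 = (4 * n%:R - 2) * s n) ->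
  fps_mul s s =1 fps_sub (fps_monom 1 0) (fps_monom 4 1).
Proof.
move=> s0 sS; set p := fps_mul s s.
(* Symmetry i <-> n - i of the terms of p n replaces the weight i by n / 2. *)
have flip n (u : nat -> R) : \sum_(i < n.+1) u (n - i)%N * (s i * s (n - i)%N) =
    \sum_(i < n.+1) u i * (s i * s (n - i)%N).
  rewrite (reindex_inj rev_ord_inj); apply: eq_bigr => i _ /=.
  by rewrite subSS subKn ?leq_ord // [s i * _]mulrC.
have weight n : 2 * (\sum_(i < n.+1) i%:R * (s i * s (n - i)%N)) = n%:R * p n.
  rewrite mulr_natl mulr2n -{1}(flip n (fun i => i%:R)) -big_split mulr_sumr.
  apply: eq_bigr => i _ /=; rewrite -mulrDl -natrD subnK ?leq_ord //.
have pS n : n.+1%:R * p n.+1 = (4 * n%:R - 4) * p n.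
  rewrite -weight big_ord_recl mul0r add0r.
  rewrite (eq_bigr (fun i : 'I_n.+1 =>
      4 * (i%:R * (s i * s (n - i)%N)) - 2 * (s i * s (n - i)%N))); last first.
    by move=> i _; rewrite /= subSS mulrA sS; ring.
  rewrite sumrB -!mulr_sumr -/(fps_mul s s n) -/(p n).
  transitivity (4 * (2 * \sum_(i < n.+1) i%:R * (s i * s (n - i)%N)) - 4 * p n).
    by ring.
  by rewrite weight; ring.
case=> [|[|n]].
- by rewrite /p /fps_mul big_ord_recl big_ord0 s0 /fps_sub /fps_monom /=; ring.
- apply: (mulfI (natr_neq0 0)); rewrite pS /fps_sub /fps_monom /=.
  by rewrite /p /fps_mul big_ord_recl big_ord0 s0; ring.
elim: n => [|n IHn].
  apply: (mulfI (natr_neq0 1)).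
  by rewrite pS /fps_sub /fps_monom /= mulr1 subrr mul0r subrr mulr0.
apply: (mulfI (natr_neq0 n.+2)).
by rewrite pS IHn /fps_sub /fps_monom /= subrr !mulr0.
Qed.

Definition sqrt_one_sub_4t : nat -> R :=
  fps_sub (fps_monom 1 0) (fps_mul (fps_monom 2 1) Cat).

Lemma sqrt_one_sub_4tS (n : nat) : sqrt_one_sub_4t n.+1 = - 2 * Cat n.
Proof.
rewrite /sqrt_one_sub_4t /fps_sub fps_mul_monom /fps_monom /= subn1.
by rewrite sub0r mulNr.
Qed.

Lemma sqrt_one_sub_4tP :
  fps_is_sqrt (fps_sub (fps_monom 1 0) (fps_monom 4 1)) sqrt_one_sub_4t.
Proof.
have s0 : sqrt_one_sub_4t 0%N = 1.
  by rewrite /sqrt_one_sub_4t /fps_sub fps_mul_monom /fps_monom /= subr0.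
split=> //; apply: fps_sqrt_rec => // -[|n].
  by rewrite sqrt_one_sub_4tS s0 Catalan0; ring.
rewrite !sqrt_one_sub_4tS mulrCA Catalan_rec -natr1; ring.
Qed.

(** Cat = 1 + t Cat^2: for s = 1 - 2t Cat, comparing coefficients of t^(n+2) in
    s^2 = 1 - 4t leaves exactly this relation, up to the factor -4. *)
Lemma Catalan_fixpoint (n : nat) : Cat n.+1 = fps_mul Cat Cat n.
Proof.
have [s0 /(_ n.+2)] := sqrt_one_sub_4tP.
rewrite /fps_mul big_ord_recl big_ord_recr /= subnn subn0 s0 mulr1 mul1r.
rewrite sqrt_one_sub_4tS.
under eq_bigr => i _.
  rewrite /bump leq0n add1n subSS subSn ?leq_ord // !sqrt_one_sub_4tS.
  rewrite (_ : _ * _ = 4 * (Cat i * Cat (n - i)%N)); last by ring.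
  over.
rewrite -mulr_sumr /fps_sub /fps_monom /= subr0 => E.
apply/eqP; rewrite -subr_eq0 -(mulrI_eq0 _ (mulfI (natr_neq0 3))) -oppr_eq0.
by apply/eqP; rewrite -[RHS]E /fps_mul; ring.
Qed.

(** Cat = 1 + t Cat^2 multiplied by Cat^k. *)
Lemma fps_pow_Catalan_rec (k m : nat) :
  fps_pow Cat k.+1 m.+1 = fps_pow Cat k m.+1 + fps_pow Cat k.+2 m.
Proof.
rewrite /fps_pow !iterS -!/(fps_pow _ k) fps_mulA.
rewrite {1}/fps_mul big_ord_recl Catalan0 mul1r subn0; congr (_ + _).
by apply: eq_bigr => i _; rewrite Catalan_fixpoint.
Qed.

(** The ballot numbers.  The preceding recurrence expresses the coefficient of
    t^(m+1) in Cat^(k+1) by a smaller exponent k in the same degree and by a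
    smaller degree, hence the nested induction. *)
Lemma fps_pow_Catalan (k m : nat) :
  fps_pow Cat k.+1 m =
  k.+1%:R * (2 * m + k)`!%:R / (m`!%:R * (m + k.+1)`!%:R).
Proof.
elim: m k => [|m IHm] k.
  have -> : fps_pow Cat k.+1 0 = 1.
    elim: k.+1 => [//|j IHj]; rewrite /fps_pow iterS -/(fps_pow _ j).
    by rewrite /fps_mul big_ord_recl big_ord0 IHj Catalan0 !mulr1 addr0.
  rewrite muln0 !add0n fact0 factS natrM.
  by field; rewrite fact_neq0 (add_natr_neq0 0).
elim: k => [|k IHk]; rewrite fps_pow_Catalan_rec IHm.
  rewrite [fps_pow _ 0 _]/= /fps_monom /= add0r.
  have -> : (2 * m + 1 = (2 * m).+1)%N by lia.
  have -> : (2 * m.+1 + 0 = (2 * m).+2)%N by lia.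
  have -> : (m + 2 = m.+2)%N by lia.
  have -> : (m.+1 + 1 = m.+2)%N by lia.
  rewrite !factS !natrM.
  by field; rewrite fact_neq0 (add_natr_neq0 0) (add_natr_neq0 1).
rewrite IHk.
have -> : (2 * m + k.+2 = (2 * m + k).+2)%N by lia.
have -> : (2 * m.+1 + k = (2 * m + k).+2)%N by lia.
have -> : (2 * m.+1 + k.+1 = (2 * m + k).+3)%N by lia.
have -> : (m + k.+3 = (m + k).+3)%N by lia.
have -> : (m.+1 + k.+2 = (m + k).+3)%N by lia.
have -> : (m.+1 + k.+1 = (m + k).+2)%N by lia.
rewrite !factS !natrM.
field; rewrite !fact_neq0 -natrD (add_natr_neq0 0) (add_natr_neq0 1).
by rewrite (add_natr_neq0 2) (add_natr_neq0 0).
Qed.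

End CharZero.
(** * Bessel numbers and rising factorials *)

(** For 0 < k <= n, the Bessel number (2n-k-1)! / (2^(n-k) (n-k)! (k-1)!), given
    by its recurrence.  The truncated subtraction is harmless: [bessel n' k'.+1]
    vanishes when [n' < k'.+1]. *)
Fixpoint bessel (n k : nat) : nat :=
  match n, k with
  | 0, 0 => 1
  | n'.+1, k'.+1 => (2 * n' - k'.+1) * bessel n' k'.+1 + bessel n' k'
  | _, _ => 0
  end.

Lemma bessel_gt (n k : nat) : (n < k)%N -> bessel n k = 0%N.
Proof.
elim: n k => [|n IHn] [|k] //= ltnk.
by rewrite !IHn ?muln0 // ltnW.
Qed.

Lemma natr_bessel_rec (R : nzRingType) (n k : nat) :
  (bessel n.+1 k.+1)%:R =
  (2 * n%:R - k.+1%:R) * (bessel n k.+1)%:R + (bessel n k)%:R :> R.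
Proof.
rewrite /= natrD natrM; congr (_ + _).
case: (leqP k.+1 n) => [lekn|/bessel_gt->]; last by rewrite !mulr0.
by rewrite natrB ?natrM //; lia.
Qed.

Section Coefficients.

Variable R : fieldType.

(** X (X + b) (X + 2b) ... with n factors: the rising factorial for b = 1, and
    for b = 2 and X = j the scalar by which (x D)^n turns y^j into y^(j + 2n) on
    the line x = y. *)
Definition step_prod (b n : nat) : {poly R} :=
  \prod_(i < n) ('X + ((b * i)%:R)%:P).

Lemma step_prodS (b n : nat) :
  step_prod b n.+1 = step_prod b n * ('X + ((b * n)%:R)%:P).
Proof. by rewrite /step_prod big_ord_recr. Qed.

Lemma size_step_prod (b n : nat) : size (step_prod b n) = n.+1.
Proof.
elim: n => [|n IHn]; first by rewrite /step_prod big_ord0 size_poly1.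
have mon : 'X + ((b * n)%:R)%:P \is @monic R by exact: monicXaddC.
by rewrite step_prodS size_Mmonic ?size_XaddC ?IHn ?addn2 // -size_poly_gt0 IHn.
Qed.

Lemma horner_step_prod (b n j : nat) :
  (step_prod b n).[j%:R] = \prod_(i < n) (j + b * i)%:R.
Proof.
rewrite horner_prod; apply: eq_bigr => i _.
by rewrite hornerD hornerX hornerC natrD.
Qed.

(** Multiply the expansion for n by X + 2n = (X + k) + (2n - k): the first
    part raises the k-th rising factorial to the next one, the second keeps
    it, which is the recurrence of [bessel]. *)
Lemma step_prod2_bessel (n : nat) :
  step_prod 2 n = \sum_(k < n.+1) (bessel n k)%:R *: step_prod 1 k.
Proof.
elim: n => [|n IHn].
  by rewrite big_ord_recl big_ord0 scale1r addr0 /step_prod !big_ord0.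
rewrite big_ord_recl /= scale0r add0r.
under [RHS]eq_bigr => k _ do
  rewrite /bump leq0n add1n natr_bessel_rec scalerDl.
rewrite big_split /=.
have -> :
    \sum_(k < n.+1)
      ((2 * n%:R - k.+1%:R) * (bessel n k.+1)%:R) *: step_prod 1 k.+1
    = \sum_(k < n.+1) ((2 * n%:R - k%:R) * (bessel n k)%:R) *: step_prod 1 k.
  rewrite big_ord_recr [RHS]big_ord_recl /= bessel_gt // mulr0 scale0r addr0.
  by case: (n) => [|m]; rewrite ?mulr0 ?subr0 ?mul0r scale0r add0r.
rewrite -big_split step_prodS IHn mulr_suml; apply: eq_bigr => k _ /=.
rewrite step_prodS -!mul_polyC mul1n natrM !(polyCM, polyCB); ring.
Qed.

(** Polynomials of pairwise distinct degrees are linearly independent: read off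
    the leading coefficient of the last term. *)
Lemma graded_free (p : nat -> {poly R}) (d : nat -> R) (n : nat) :
  (forall k, size (p k) = k.+1) -> \sum_(k < n) d k *: p k = 0 ->
  forall k, (k < n)%N -> d k = 0.
Proof.
move=> sz; elim: n => [//|n IHn] E.
have dn : d n = 0.
  have := congr1 (fun q : {poly R} => q`_n) E.
  rewrite coef0 big_ord_recr /= coefD coef_sum big1 => [|i _]; last first.
    by rewrite coefZ nth_default ?mulr0 // sz ltn_ord.
  rewrite add0r coefZ => /eqP; rewrite mulf_eq0 => /orP[/eqP//|].
  have -> : (p n)`_n = lead_coef (p n) by rewrite lead_coefE sz.
  by rewrite lead_coef_eq0 -size_poly_eq0 sz.
move=> k; rewrite ltnS leq_eqVlt => /orP[/eqP->//|]; apply: IHn.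
by move: E; rewrite big_ord_recr /= dn scale0r addr0.
Qed.

Section BesselCharZero.

Hypothesis charR0 : [pchar R] =i pred0.

Lemma natr_bessel (m k : nat) :
  (bessel (m + k).+1 k.+1)%:R =
  (2 * m + k)`!%:R / (2 ^+ m * m`!%:R * k`!%:R) :> R.
Proof.
have two : 2%:R != 0 :> R := natr_neq0 charR0 1.
elim: m k => [|m IHm] k.
  elim: k => [|k IHk]; first by rewrite expr0 muln0 addn0 fact0 !mulr1 divr1.
  rewrite natr_bessel_rec IHk muln0 !add0n bessel_gt // expr0 fact0.
  by field; rewrite !(fact_neq0 charR0).
elim: k => [|k IHk]; rewrite natr_bessel_rec.
  rewrite [bessel (m.+1 + 0) 0]/= [(m.+1 + 0)%N]addSn IHm !addn0.
  rewrite (_ : 2 * m.+1 = (2 * m).+2)%N; last by lia.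
  rewrite fact0 !factS exprS !natrM.
  by field; rewrite expf_neq0 ?two ?fact_neq0 ?(add_natr_neq0 charR0 0).
have -> : (m.+1 + k.+1 = (m.+1 + k).+1)%N by lia.
rewrite IHk.
have -> : ((m.+1 + k).+1 = (m + k.+1).+1)%N by lia.
rewrite IHm.
have -> : (2 * m + k.+1 = (2 * m + k).+1)%N by lia.
have -> : (2 * m.+1 + k = (2 * m + k).+2)%N by lia.
have -> : (2 * m.+1 + k.+1 = (2 * m + k).+3)%N by lia.
rewrite !factS exprS !natrM.
by field; rewrite expf_neq0 ?two ?fact_neq0 ?(add_natr_neq0 charR0 0).
Qed.

Lemma poly_natr_eq0 (p : {poly R}) : (forall j : nat, p.[j%:R] = 0) -> p = 0.
Proof.
move=> p0; apply/eqP/contraT => pn0.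
have natI : injective (fun j : nat => j%:R : R).
  move=> j k; wlog lejk : j k / (j <= k)%N => [wl|].
    by case: (leqP j k) => [|/ltnW] le E; [|apply: esym]; apply: wl.
  move/esym/eqP; rewrite -subr_eq0 -natrB // ((pcharf0P R).1 charR0) => le0.
  by apply/eqP; rewrite eqn_leq lejk.
have := @max_poly_roots _ p [seq j%:R | j <- iota 0 (size p)] pn0.
rewrite map_inj_uniq // iota_uniq size_map size_iota ltnn; apply=> //.
by apply/allP => _ /mapP[j _ ->]; rewrite rootE p0.
Qed.

End BesselCharZero.

(** * Restriction to the diagonal *)

Lemma iter_Xderiv (b n j : nat) :
  iter n (fun q : {poly R} => 'X^(b.+1) * q^`()) 'X^j =
  (\prod_(i < n) (j + b * i)%:R) *: 'X^(j + b * n).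
Proof.
elim: n => [|n IHn]; first by rewrite big_ord0 scale1r muln0 addn0.
rewrite iterS IHn derivZ derivXn -scaler_nat -!scalerAr big_ord_recr /= scalerA.
rewrite -exprD mulnS (addnCA j).
by case: (j + b * n)%N => [|m]; rewrite ?mulr0 ?scale0r // addSnnS.
Qed.

Definition diag : {mpoly R[2]} -> {poly R} := mmap polyC (fun=> 'X).

Lemma diagM : {morph diag : p q / p * q}.
Proof. exact: rmorphM. Qed.

Lemma diagD : {morph diag : p q / p + q}.
Proof. exact: raddfD. Qed.

Lemma diagZ (c : R) (p : {mpoly R[2]}) : diag (c *: p) = c *: diag p.
Proof. by rewrite /diag mmapZ mul_polyC. Qed.

Lemma diagC (c : R) : diag c%:MP = c%:P.
Proof. exact: mmapC. Qed.

Lemma diagXn (p : {mpoly R[2]}) n : diag (p ^+ n) = diag p ^+ n.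
Proof. exact: rmorphXn. Qed.

Lemma diag_sum I (r : seq I) (F : I -> {mpoly R[2]}) :
  diag (\sum_(i <- r) F i) = \sum_(i <- r) diag (F i).
Proof. exact: raddf_sum. Qed.

Lemma diagX (i : 'I_2) : diag 'X_i = 'X.
Proof. by rewrite /diag mmapX mmap1U. Qed.

(** Both sides are derivations along [diag], so it is enough to compare them on
    the two variables; there D x = D y = y^2 is what matters. *)
Lemma diag_derivation (D : {linear {mpoly R[2]} -> {mpoly R[2]}}) :
  is_DG D -> forall p, diag (D p) = 'X^2 * (diag p)^`().
Proof.
case=> DM DC Dx Dy.
pose good p := diag (D p) = 'X^2 * (diag p)^`().
have goodM p q : good p -> good q -> good (p * q).
  rewrite /good => gp gq.
  by rewrite DM diagD !diagM gp gq derivM; ring.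
have goodC c : good c%:MP.
  by rewrite /good DC -mpolyC0 !diagC !derivC mulr0.
have goodX (i : 'I_2) : good 'X_i.
  rewrite /good diagX derivX mulr1.
  have [->|->] : i = inord 0 \/ i = inord 1.
  - by case: i => -[|[|//]] lti; [left|right]; apply/val_inj; rewrite /= inordK.
  - by rewrite Dx /vy expr2 diagM diagX.
  - by rewrite Dy /vy expr2 diagM diagX.
have goodXn i m : good ('X_i ^+ m).
  by elim: m => [|m IHm]; [exact: (goodC 1) | rewrite exprS; exact: goodM].
elim/mpolyind => [|c m p _ _ gp].
  by rewrite -/(good 0) -mpolyC0; exact: goodC.
rewrite linearD !diagD derivD mulrDr gp.
congr (_ + _); rewrite -/(good _) -mul_mpolyC; apply: (goodM) => //.
rewrite mpolyXE_id; elim/big_rec: _ => [|i q _ gq]; first exact: (goodC 1).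
exact: goodM.
Qed.

Section RowSums.

Hypothesis charR0 : [pchar R] =i pred0.
Variables (D : {linear {mpoly R[2]} -> {mpoly R[2]}}) (hD : is_DG D).
Variables (C : nat -> nat -> nat -> R) (hC : normal_ordered_coefs D C).

Lemma diag_iter (n : nat) p :
  diag (iter n D p) = iter n (fun q : {poly R} => 'X^2 * q^`()) (diag p).
Proof. by elim: n => [//|n IHn]; rewrite !iterS diag_derivation // IHn. Qed.

Lemma diag_iter_x (n : nat) p :
  diag (iter n (fun g => vx R * D g) p) =
  iter n (fun q : {poly R} => 'X^3 * q^`()) (diag p).
Proof.
elim: n => [//|n IHn]; rewrite !iterS diagM diag_derivation // IHn diagX.
by rewrite mulrA -exprS.
Qed.

(** Applying the operators to y^j and restricting to x = y gives an identity
    between values at j of two combinations of rising factorials, one with the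
    row sums of C and one with Bessel numbers; as j is arbitrary, the
    coefficients agree. *)
Lemma row_sum_bessel (n k : nat) : (0 < k <= n)%N ->
  \sum_(k <= l < n.+1) C n k l = (bessel n k)%:R.
Proof.
case/andP => k_gt0 lekn.
have n_gt0 : (0 < n)%N by exact: leq_trans lekn.
(* The index 0 is absent from the expansion; Bessel numbers vanish there too. *)
pose c i := if i == 0%N then 0 else \sum_(i <= l < n.+1) C n i l.
pose d i := c i - (bessel n i)%:R.
suff : d k = 0 by rewrite /d /c gtn_eqF // => /eqP; rewrite subr_eq0 => /eqP.
apply: (@graded_free (step_prod 1) d n.+1); [exact: size_step_prod | | by []].
under eq_bigr do rewrite scalerBl.
rewrite sumrB -step_prod2_bessel; apply: (poly_natr_eq0 charR0) => j.
rewrite hornerD hornerN horner_step_prod horner_sum.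
apply/eqP; rewrite subr_eq0; apply/eqP.
have := congr1 diag (hC n_gt0 (vy R ^+ j)).
rewrite diag_iter_x // diagXn diagX iter_Xderiv diag_sum.
rewrite (eq_big_nat _ _ (F2 := fun i =>
    (c i * (step_prod 1 i).[j%:R]) *: 'X^(j + 2 * n))); last first.
  move=> i /andP[i_gt0 lein]; rewrite diag_sum.
  rewrite /c gtn_eqF // horner_step_prod mulr_suml scaler_suml.
  apply: eq_big_nat => l /andP[leil leln].
  rewrite diagZ !diagM diag_iter // !diagXn !diagX iter_Xderiv.
  rewrite -!scalerAr scalerA -!exprD.
  congr (_ *: 'X^_); lia.
rewrite -scaler_suml => /(congr1 (fun q : {poly R} => q`_(j + 2 * n))).
rewrite !coefZ coefXn eqxx !mulr1 => ->.
rewrite big_ord_recl hornerZ [c _]/c eqxx mul0r add0r big_add1 big_mkord.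
by apply: eq_bigr => i _; rewrite hornerZ.
Qed.

End RowSums.
End Coefficients.

(** * The exponential formula *)

Lemma fps_exp_monom1_comp (R : fieldType) (A : comAlgType R) (f : nat -> R)
    (a b : A) (n : nat) :
  fps_exp (fps_mul (fps_monom a 1) (fps_comp f (fps_monom b 1))) n =
  \sum_(k < n.+1)
    ((k`!%:R)^-1 * fps_pow f k (n - k)) *: (a ^+ k * b ^+ (n - k)).
Proof.
apply: eq_bigr => k _; rewrite fps_pow_mul_monom1 fps_mul_monom leq_ord.
by rewrite (eq_fps_pow _ (fps_comp_monom1 _ _)) fps_pow_scale -scalerAr scalerA.
Qed.

Lemma bessel_Catalan (R : fieldType) (charR0 : [pchar R] =i pred0) (n k : nat) :
  (k <= n)%N ->
  (k`!%:R)^-1 * fps_pow (@Catalan_series R) k (n - k) * 2^-1 ^+ (n - k) =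
  (n`!%:R)^-1 * (bessel n k)%:R.
Proof.
case: k => [|k] => [_|lekn].
  by case: n => [|n]; rewrite /fps_pow /= /fps_monom /= ?mulr0 ?mul0r ?mulr1.
have [m ->] : exists m, (n = m + k.+1)%N by exists (n - k.+1)%N; rewrite subnK.
rewrite addnK fps_pow_Catalan // addnS natr_bessel // !factS !natrM exprVn.
field; rewrite -natrD !fact_neq0 ?(add_natr_neq0 charR0 0) // expf_neq0 //.
exact: (natr_neq0 charR0 1).
Qed.

(** With x = y the exponents of x and y add up to 2n - k whatever l is, so only
    the row sums of C remain. *)
Lemma Ctilde_diag (R : fieldType) (charR0 : [pchar R] =i pred0)
    (D : {linear {mpoly R[2]} -> {mpoly R[2]}}) (hD : is_DG D)
    (C : nat -> nat -> nat -> R) (hC : normal_ordered_coefs D C)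
    (A : comAlgType R) (x z : A) (n : nat) :
  Ctilde C n x x z =
  \sum_(k < n.+1) (bessel n k)%:R *: (x ^+ (2 * n - k) * z ^+ k).
Proof.
case: n => [|n]; first by rewrite big_ord_recl big_ord0 scale1r mul1r addr0.
rewrite big_ord_recl scale0r add0r /Ctilde big_add1 big_mkord.
apply: eq_bigr => k _.
rewrite -(row_sum_bessel charR0 hD hC); last by rewrite /= ltn_ord.
rewrite scaler_suml; apply: eq_big_nat => l /andP[lekl leln].
rewrite -exprD; congr (_ *: (_ ^+ _ * _)).
by rewrite /= /bump leq0n add1n; move: (nat_of_ord k) lekl => i leil; lia.
Qed.

Unset Implicit Arguments.

Theorem theorem13 (R : fieldType) (charR0 : [pchar R] =i pred0)
    (D : {linear {mpoly R[2]} -> {mpoly R[2]}}) (hD : is_DG D)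
    (C : nat -> nat -> nat -> R) (hC : normal_ordered_coefs D C)
    (x : {mpoly R[2]}) (hx : x = 'X_(inord 0))
    (z : {mpoly R[2]}) (hz : z = 'X_(inord 1)) :
  (exists2 s : nat -> R,
     fps_is_sqrt (fps_sub (fps_monom 1 0) (fps_monom 4 1)) s &
     fps_mul (fps_monom 2 1) (@Catalan_series R)
       =1 fps_sub (fps_monom 1 0) s) /\
  Ctilde_series C x x z
    =1 fps_exp (fps_mul (fps_monom (x * z) 1)
         (fps_comp (@Catalan_series R) (fps_monom (2^-1 *: x ^+ 2) 1))).
Proof.
split.
  exists (@sqrt_one_sub_4t R); first exact: sqrt_one_sub_4tP.
  by move=> n; rewrite /sqrt_one_sub_4t /fps_sub opprB addrC subrK.
move=> n; rewrite fps_exp_monom1_comp /Ctilde_series (Ctilde_diag charR0 hD hC).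
rewrite scaler_sumr; apply: eq_bigr => k _.
rewrite scalerA -bessel_Catalan ?leq_ord // -scalerA exprZn exprMn.
congr (_ *: _); rewrite -scalerAr; congr (_ *: _).
rewrite -exprM mulrAC -exprD; congr (_ ^+ _ * _).
by have := leq_ord k; lia.
Qed.
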